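(* Let $\mathbf A\in\mathbb H^{n\times n}$ be invertible and $\mathbf b\in\mathbb H^{1\times n}$ a constant row vector. The particular solution $\mathbf x(t)=-\mathbf b\mathbf A^{-1}=(x_1,\dots,x_n)$ of the left system $\mathbf x'(t)=\mathbf x(t)\mathbf A+\mathbf b$ possesses the following determinantal representations for all $i=1,\dots,n$: (i) if $\mathbf A$ is Hermitian, $\displaystyle x_i=-\frac{\operatorname{rdet}_i\mathbf A_{i.}(\mathbf b)}{\det\mathbf A}$; (ii) if $\mathbf A$ is arbitrary, $\displaystyle x_i=-\frac{\operatorname{rdet}_i(\mathbf A\mathbf A^{*})_{i.}(\mathbf b\mathbf A^{*})}{\operatorname{ddet}\mathbf A}$.
   Context: $\mathbb H$ is the real quaternion skew field; $\mathbf A^{*}$ is the conjugate transpose; $\mathbf A$ is Hermitian if $\mathbf A^*=\mathbf A$. Derivatives are componentwise in the real variable $t$. Row determinants: for $\mathbf M=(m_{ij})\in\mathbb H^{n\times n}$ and $i\in\{1,\dots,n\}$, $$\operatorname{rdet}_i\mathbf M=\sum_{\sigma\in S_n}(-1)^{n-p}\,(m_{i\,i_{k_1}}m_{i_{k_1}i_{k_1+1}}\cdots m_{i_{k_1+l_1}i})\cdots(m_{i_{k_p}i_{k_p+1}}\cdots m_{i_{k_p+l_p}i_{k_p}}),$$ where $\sigma$ is written as a product of its $p$ disjoint cycles (fixed points included) $\sigma=(i\,i_{k_1}i_{k_1+1}\dots i_{k_1+l_1})(i_{k_2}i_{k_2+1}\dots i_{k_2+l_2})\cdots(i_{k_p}i_{k_p+1}\dots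 i_{k_p+l_p})$ with $i_{k_2}<i_{k_3}<\dots<i_{k_p}$ and $i_{k_t}<i_{k_t+s}$ for $t=2,\dots,p$, $s=1,\dots,l_t$ (the cycle containing $i$ is the leftmost one; a fixed point $c$ contributes $m_{cc}$). For a Hermitian matrix all row determinants (and all column determinants) coincide and are real; their common value is $\det\mathbf M$. The double determinant is $\operatorname{ddet}\mathbf A:=\det(\mathbf A^{*}\mathbf A)=\det(\mathbf A\mathbf A^{*})$. $\mathbf M_{i.}(\mathbf c)$ is the matrix obtained from $\mathbf M$ by replacing its $i$th row by $\mathbf c$. *)

(* Defs.v *)
From HB Require Import structures.
From mathcomp Require Import all_boot all_order all_algebra all_fingroup.
From mathcomp Require Import ring lra.
From mathcomp Require Import all_classical all_reals all_analysis.

Set Implicit Arguments.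
Unset Strict Implicit.
Unset Printing Implicit Defensive.

Import Order.TTheory GRing.Theory Num.Theory.
Import numFieldNormedType.Exports.

Local Open Scope ring_scope.

(* The real quaternions a + b i + c j + d k, as a skew field
   (a [unitRingType] in which every nonzero element is a unit) and an algebra
   over [R]; the real number [r] is embedded as [r%:A]. *)
Record quat (R : realType) : Type :=
  Quat { qre : R; qim_i : R; qim_j : R; qim_k : R }.

Section QuaternionRing.
Variable R : realType.
Implicit Types p q r : quat R.

Lemma quat_ext p q :
  qre p = qre q -> qim_i p = qim_i q -> qim_j p = qim_j q ->
  qim_k p = qim_k q -> p = q.
Proof.
by case: p => ? ? ? ?; case: q => ? ? ? ? /= -> -> -> ->.
Qed.

Definition quat_to_tuple q : R * R * R * R :=
  (qre q, qim_i q, qim_j q, qim_k q).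
Definition quat_of_tuple (u : R * R * R * R) : quat R :=
  let: (a, b, c, d) := u in Quat a b c d.

Fact quat_to_tupleK : cancel quat_to_tuple quat_of_tuple.
Proof. by case. Qed.

HB.instance Definition _ := Choice.copy (quat R) (can_type quat_to_tupleK).

Definition addq p q : quat R :=
  Quat (qre p + qre q) (qim_i p + qim_i q)
       (qim_j p + qim_j q) (qim_k p + qim_k q).
Definition oppq p : quat R :=
  Quat (- qre p) (- qim_i p) (- qim_j p) (- qim_k p).
Definition zeroq : quat R := Quat 0 0 0 0.
Definition oneq : quat R := Quat 1 0 0 0.

Definition mulq p q : quat R :=
  let: Quat a1 b1 c1 d1 := p in
  let: Quat a2 b2 c2 d2 := q in
  Quat (a1 * a2 - b1 * b2 - c1 * c2 - d1 * d2)
       (a1 * b2 + b1 * a2 + c1 * d2 - d1 * c2)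
       (a1 * c2 - b1 * d2 + c1 * a2 + d1 * b2)
       (a1 * d2 + b1 * c2 - c1 * b2 + d1 * a2).

Definition scaleq (x : R) q : quat R :=
  Quat (x * qre q) (x * qim_i q) (x * qim_j q) (x * qim_k q).

Definition conjq q : quat R :=
  Quat (qre q) (- qim_i q) (- qim_j q) (- qim_k q).

Definition normsq q : R :=
  qre q ^+ 2 + qim_i q ^+ 2 + qim_j q ^+ 2 + qim_k q ^+ 2.

Definition invq q : quat R := scaleq (normsq q)^-1 (conjq q).

Fact addqA : associative addq.
Proof. by move=> *; apply: quat_ext => /=; rewrite addrA. Qed.
Fact addqC : commutative addq.
Proof. by move=> *; apply: quat_ext => /=; rewrite addrC. Qed.
Fact add0q : left_id zeroq addq.
Proof. by move=> *; apply: quat_ext => /=; rewrite add0r. Qed.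
Fact addNq : left_inverse zeroq oppq addq.
Proof. by move=> *; apply: quat_ext => /=; rewrite addNr. Qed.

HB.instance Definition _ :=
  GRing.isZmodule.Build (quat R) addqA addqC add0q addNq.

Fact mulqA : associative mulq.
Proof.
move=> [a1 b1 c1 d1] [a2 b2 c2 d2] [a3 b3 c3 d3].
by apply: quat_ext => /=; ring.
Qed.
Fact mul1q : left_id oneq mulq.
Proof. by move=> [a b c d]; apply: quat_ext => /=; ring. Qed.
Fact mulq1 : right_id oneq mulq.
Proof. by move=> [a b c d]; apply: quat_ext => /=; ring. Qed.
Fact mulqDl : left_distributive mulq addq.
Proof.
move=> [a1 b1 c1 d1] [a2 b2 c2 d2] [a3 b3 c3 d3].
by apply: quat_ext => /=; ring.
Qed.
Fact mulqDr : right_distributive mulq addq.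
Proof.
move=> [a1 b1 c1 d1] [a2 b2 c2 d2] [a3 b3 c3 d3].
by apply: quat_ext => /=; ring.
Qed.
Fact oneq_neq0 : oneq != 0.
Proof. by apply/eqP => -[] /eqP; rewrite oner_eq0. Qed.

HB.instance Definition _ :=
  GRing.Zmodule_isNzRing.Build (quat R) mulqA mul1q mulq1 mulqDl mulqDr
    oneq_neq0.

Fact scaleqA x y q : scaleq x (scaleq y q) = scaleq (x * y) q.
Proof. by apply: quat_ext => /=; rewrite mulrA. Qed.
Fact scale1q : left_id 1 scaleq.
Proof. by move=> q; apply: quat_ext => /=; rewrite mul1r. Qed.
Fact scaleqDr : right_distributive scaleq +%R.
Proof. by move=> x p q; apply: quat_ext => /=; rewrite mulrDr. Qed.
Fact scaleqDl q : {morph scaleq^~ q : x y / x + y}.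
Proof. by move=> x y; apply: quat_ext => /=; rewrite mulrDl. Qed.

HB.instance Definition _ :=
  GRing.Zmodule_isLmodule.Build R (quat R) scaleqA scale1q scaleqDr scaleqDl.

Fact scaleqAl (x : R) p q : x *: (p * q) = x *: p * q.
Proof.
by case: p q => [a1 b1 c1 d1] [a2 b2 c2 d2]; apply: quat_ext => /=; ring.
Qed.
Fact scaleqAr (x : R) p q : x *: (p * q) = p * (x *: q).
Proof.
by case: p q => [a1 b1 c1 d1] [a2 b2 c2 d2]; apply: quat_ext => /=; ring.
Qed.

HB.instance Definition _ :=
  GRing.Lmodule_isLalgebra.Build R (quat R) scaleqAl.
HB.instance Definition _ :=
  GRing.Lalgebra_isAlgebra.Build R (quat R) scaleqAr.

Fact normsq_eq0 q : (normsq q == 0) = (q == 0).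
Proof.
apply/idP/eqP => [|->]; last by rewrite /normsq /= !expr0n !addr0.
rewrite /normsq !paddr_eq0 ?addr_ge0 ?sqr_ge0 // !sqrf_eq0.
move=> /andP[/andP[/andP[/eqP ? /eqP ?] /eqP ?] /eqP ?].
exact: quat_ext.
Qed.

Fact mulVq : {in [pred q | q != 0], left_inverse 1 invq *%R}.
Proof.
move=> q; rewrite inE -normsq_eq0; case: q => a b c d.
by rewrite /normsq /= => q0; apply: quat_ext => /=; rewrite /normsq /=; field.
Qed.
Fact mulqV : {in [pred q | q != 0], right_inverse 1 invq *%R}.
Proof.
move=> q; rewrite inE -normsq_eq0; case: q => a b c d.
by rewrite /normsq /= => q0; apply: quat_ext => /=; rewrite /normsq /=; field.
Qed.
Fact unitqP p q : q * p = 1 /\ p * q = 1 -> [pred q | q != 0] p.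
Proof.
move=> [qp1 _] /=; apply/eqP => p0.
by move: qp1; rewrite p0 mulr0 => /eqP; rewrite eq_sym oner_eq0.
Qed.
Fact invq_out : {in [predC [pred q | q != 0]], invq =1 id}.
Proof.
move=> q; rewrite !inE negbK => /eqP ->.
by apply: quat_ext; rewrite /= ?oppr0 mulr0.
Qed.

HB.instance Definition _ :=
  GRing.NzRing_hasMulInverse.Build (quat R) mulVq mulqV unitqP invq_out.

End QuaternionRing.

Section QuaternionMatrices.
Variable R : realType.

(* [unitmx] and [invmx] are only available over commutative rings. *)
Definition mx_inverse n (A B : 'M[quat R]_n) : Prop :=
  A *m B = 1%:M /\ B *m A = 1%:M.

Definition ctransmx m n (A : 'M[quat R]_(m, n)) : 'M[quat R]_(n, m) :=
  map_mx (@conjq R) A^T.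

Definition hermitian_mx n (A : 'M[quat R]_n) : Prop := ctransmx A = A.

Definition replace_row n (M : 'M[quat R]_n) (i : 'I_n) (c : 'rV[quat R]_n) :
    'M[quat R]_n :=
  \matrix_(k, j) if k == i then c 0 j else M k j.

(* The [traject] lists c, s c, s (s c), ... once around the cycle of c, so this
   is the ordered product m_{c s(c)} m_{s(c) s(s(c))} ... m_{s^-1(c) c}. *)
Definition cycle_prod n (M : 'M[quat R]_n) (s : 'S_n) (c : 'I_n) : quat R :=
  \prod_(k <- traject s c #|porbit s c|) M k (s k).

(* c is the least element of its cycle. *)
Definition cycle_leader n (s : 'S_n) (c : 'I_n) : bool :=
  [forall k in porbit s c, (c <= k)%N].

(* The cycle of i comes first, read from i; the other cycles follow, each read
   from its least element, by increasing least elements ([\prod_(c < n)] is an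
   ordered product). [porbits s] includes the fixed points. *)
Definition rdet n (i : 'I_n) (M : 'M[quat R]_n) : quat R :=
  \sum_(s : 'S_n) (-1) ^+ (n - #|porbits s|) *
    (cycle_prod M s i *
     \prod_(c < n | (c \notin porbit s i) && cycle_leader s c)
        cycle_prod M s c).

(* The common real value of the row determinants of a Hermitian matrix (0 if
   they do not have one; for n = 0 the value is irrelevant). *)
Definition hdet n (M : 'M[quat R]_n) : R :=
  xget 0 [set d : R | forall i : 'I_n, rdet i M = d%:A]%classic.

Definition ddet n (A : 'M[quat R]_n) : R := hdet (ctransmx A *m A).

Definition is_qderive (f : R -> quat R) (t : R) (df : quat R) : Prop :=
  [/\ is_derive t 1 (fun u => qre (f u)) (qre df),
      is_derive t 1 (fun u => qim_i (f u)) (qim_i df),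
      is_derive t 1 (fun u => qim_j (f u)) (qim_j df) &
      is_derive t 1 (fun u => qim_k (f u)) (qim_k df)].

(* x'(t) = x(t) A + b for every real t *)
Definition left_system_solution n (A : 'M[quat R]_n) (b : 'rV[quat R]_n)
    (x : R -> 'rV[quat R]_n) : Prop :=
  forall (t : R) (j : 'I_n),
    is_qderive (fun u => x u 0 j) t ((x t *m A + b) 0 j).

End QuaternionMatrices.

(* Main.v *)
Require Import Defs.
From mathcomp Require Import all_boot all_order all_algebra all_fingroup.
From mathcomp Require Import ring lra zify.
From mathcomp Require Import all_classical all_reals all_analysis.

Set Implicit Arguments.
Unset Strict Implicit.
Unset Printing Implicit Defensive.

Import Order.TTheory GRing.Theory Num.Theory.

Local Open Scope ring_scope.

(** The constant function [x = - b A^-1] has derivative 0 and satisfies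
[x A + b = 0], so it solves the system; the rest is Cramer's rule over the
quaternions.  In [rdet i N] every term begins with an entry of row [i], so
[rdet i] is left linear in that row.  If [M] is Hermitian and [y M = c], then
[c] is a left combination of the rows of [M], and
[rdet i (replace_row M i c) = y_i det M] as soon as [rdet i] vanishes on a
matrix obtained from [M] by copying another row into row [i]
([cramer_hermitian]).  With [y = b A^-1], case (i) takes [M = A] and case (ii)
takes [M = A A^H], for which [y M = b A^H], where [A^H] is the conjugate
transpose.

Both facts about Hermitian matrices come from one device.  Reversing a single
cycle of a permutation conjugates the product of entries read along it and
changes nothing else, so averaging over the reversal replaces that product by
its real part, which is central and does not depend on the starting point
([flip_average]).  Doing this for every cycle writes all the row determinants
as the same real number [hermdet M] ([rdet_hermitian]).  When rows [i] and [k]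
are equal, multiplying by the transposition of [i] and [k] pairs the
permutations that have [i] and [k] in one cycle with those that do not; the
paired terms are opposite once the loop through [k] is averaged
([rdet_equal_rows]).

It remains to see that the denominators do not vanish and that [det (A A^H)]
equals [det (A^H A)].  A congruence [M |-> E M E^H] by an invertible
elementary matrix multiplies [hermdet M] by a positive real number, and so does
[M |-> E^H M E], with the same number ([has_multiplier_elem]).  Gaussian elimination extends
this to all invertible [A], with a nonzero multiplier
([invertible_has_multiplier]); applying it to the identity matrix gives
[det (A A^H) = det (A^H A)].  Finally, elementary congruences diagonalize an
invertible Hermitian matrix, hence its determinant is nonzero
([hermdet_neq0]). *)

(** * Quaternion conjugation and real scalars *)

Section QuaternionConjugation.
Variable R : realType.
Implicit Types p q : quat R.

Lemma conjq0 : conjq 0 = 0 :> quat R.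
Proof. by apply: quat_ext => //=; rewrite oppr0. Qed.

Lemma conjq1 : conjq 1 = 1 :> quat R.
Proof. by apply: quat_ext => //=; rewrite oppr0. Qed.

Lemma conjqK : involutive (@conjq R).
Proof. by move=> q; apply: quat_ext => //=; rewrite opprK. Qed.

Lemma conjqD p q : conjq (p + q) = conjq p + conjq q.
Proof. by apply: quat_ext => //=; rewrite opprD. Qed.

Lemma conjqM p q : conjq (p * q) = conjq q * conjq p.
Proof.
by case: p q => [a1 b1 c1 d1] [a2 b2 c2 d2]; apply: quat_ext => /=; ring.
Qed.

Lemma qreMC p q : qre (p * q) = qre (q * p).
Proof. by case: p q => [a1 b1 c1 d1] [a2 b2 c2 d2] /=; ring. Qed.

Lemma qre_alg (r : R) : qre (r%:A : quat R) = r.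
Proof. by rewrite /= mulr1. Qed.

Lemma alg_injq (r s : R) : r%:A = s%:A :> quat R -> r = s.
Proof. by move=> /(congr1 (@qre R)); rewrite !qre_alg. Qed.

Lemma addq_conj q : q + conjq q = (qre q + qre q)%:A.
Proof. by apply: quat_ext => /=; rewrite ?mulr1 ?mulr0 ?subrr. Qed.

Lemma conjq_real q : conjq q = q -> q = (qre q)%:A.
Proof.
case: q => a b c d [hb hc hermdet]; apply: quat_ext => /=; lra.
Qed.

Lemma mulq_conj q : q * conjq q = (normsq q)%:A.
Proof. by case: q => a b c d; rewrite /normsq; apply: quat_ext => /=; ring. Qed.

Lemma double_injq p q : p + p = q + q -> p = q.
Proof.
case: p q => [a b c d] [a' b' c' d'] [ha hb hc hermdet].
by apply: quat_ext => /=; lra.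
Qed.

Lemma algqM (r s : R) : (r * s)%:A = r%:A * s%:A :> quat R.
Proof. by rewrite mulr_algl scalerA. Qed.

Lemma algq_sign m : ((-1) ^+ m : R)%:A = (-1) ^+ m :> quat R.
Proof.
by elim: m => [|m IHm]; rewrite ?scale1r // !exprS algqM IHm scaleN1r.
Qed.

Lemma algqC (r : R) q : r%:A * q = q * r%:A.
Proof. by rewrite mulr_algl mulr_algr. Qed.

Lemma alg_unitq (r : R) : r != 0 -> (r%:A : quat R) \is a GRing.unit.
Proof.
move=> r0; change ((r%:A : quat R) != 0); apply: contra_neq r0 => r0.
by apply: alg_injq; rewrite r0 scale0r.
Qed.

Lemma conjq_sum (I : Type) (r : seq I) (P : pred I) (F : I -> quat R) :
  conjq (\sum_(k <- r | P k) F k) = \sum_(k <- r | P k) conjq (F k).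
Proof. by apply: (big_morph (@conjq R)); [exact: conjqD | exact: conjq0]. Qed.

Lemma conjq_prod_nat m (F : nat -> quat R) :
  conjq (\prod_(0 <= j < m) F j) = \prod_(0 <= j < m) conjq (F (m - j.+1)%N).
Proof.
elim: m => [|m IHm]; first by rewrite !big_nil conjq1.
rewrite big_nat_recr //= conjqM IHm big_nat_recl //= subn1 /=.
by congr (_ * _); apply: eq_big_nat => j _; rewrite subSS.
Qed.

End QuaternionConjugation.

(** * Reversing one cycle of a permutation *)

Section FlipCycle.
Variables (T : finType).
Implicit Types (s : {perm T}) (c x y : T).

Lemma porbit_memM s c x : (s x \in porbit s c) = (x \in porbit s c).
Proof.
by have := porbit_perm s 1 x; rewrite expg1 -!eq_porbit_mem => ->.
Qed.

Lemma porbit_memV s c x : (s^-1%g x \in porbit s c) = (x \in porbit s c).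
Proof. by rewrite -porbit_memM permKV. Qed.

Lemma porbit_trans s c x y :
  x \in porbit s c -> (y \in porbit s x) = (y \in porbit s c).
Proof.
by move=> xc; have /eqP-> : porbit s x == porbit s c by rewrite eq_porbit_mem.
Qed.

Definition flip_fun s c x := if x \in porbit s c then s^-1%g x else s x.

Lemma flip_fun_inj s c : injective (flip_fun s c).
Proof.
move=> x y; rewrite /flip_fun.
case: ifPn => hx; case: ifPn => hy.
- exact: perm_inj.
- by move=> e; move: hx hy; rewrite -(porbit_memV s) e porbit_memM => ->.
- move=> e; move: hx hy; rewrite -(porbit_memV s c y) -e porbit_memM.
  by move=> /negPf->.
- exact: perm_inj.
Qed.

Definition flip s c : {perm T} := perm (@flip_fun_inj s c).

Lemma flip_in s c x : x \in porbit s c -> flip s c x = s^-1%g x.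
Proof. by rewrite permE /flip_fun => ->. Qed.

Lemma flip_out s c x : x \notin porbit s c -> flip s c x = s x.
Proof. by rewrite permE /flip_fun => /negPf->. Qed.

Lemma porbit_closed (s : {perm T}) (A : {set T}) x :
  x \in A -> (forall y, y \in A -> s y \in A) -> porbit s x \subset A.
Proof.
move=> xA sA; apply/fintype.subsetP => y /porbitP[i ->].
by elim: i => [|i IH]; rewrite ?perm1 // expgSr permM; apply: sA.
Qed.

Lemma flip_porbit s c x : porbit (flip s c) x = porbit s x.
Proof.
have sub1 : porbit (flip s c) x \subset porbit s x.
  apply: porbit_closed; first exact: porbit_id.
  move=> y hy; rewrite permE /flip_fun.
  by case: ifP; rewrite ?porbit_memV ?porbit_memM.
apply/eqP; rewrite finset.eqEsubset sub1 /=.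
apply: porbit_closed; first exact: porbit_id.
move=> y hy; have [hyc|hyc] := boolP (y \in porbit s c).
  rewrite -(porbit_memM (flip s c)) flip_in ?porbit_memM //.
  by rewrite permK.
by rewrite -(flip_out hyc) porbit_memM.
Qed.

Lemma flipK c : involutive (flip^~ c).
Proof.
move=> s; apply/permP => x.
have [hx|hx] := boolP (x \in porbit s c); last first.
  by rewrite !flip_out ?flip_porbit.
rewrite flip_in ?flip_porbit //; apply: (@perm_inj _ (flip s c)).
by rewrite permKV flip_in ?porbit_memM // permK.
Qed.

Lemma flip_porbits s c : porbits (flip s c) = porbits s.
Proof. by rewrite /porbits; apply: eq_imset => x; rewrite flip_porbit. Qed.

(** The reversed cycle visits the points of the cycle backwards: after [m] of
its [l] steps it is where the original one is after [l - m] steps. *)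
Lemma iter_flip s c x m : x \in porbit s c -> (m <= #|porbit s c|)%N ->
  iter m (flip s c) x = iter (#|porbit s c| - m) s x.
Proof.
move=> hx; elim: m => [|m IH] hm.
  rewrite subn0 /=; move: hx; rewrite -eq_porbit_mem => /eqP <-.
  by rewrite iter_porbit.
have hin : iter (#|porbit s c| - m) s x \in porbit s c.
  rewrite -permX; move: hx; rewrite -!eq_porbit_mem porbit_perm //.
rewrite iterS IH 1?ltnW // flip_in //.
by rewrite -{1}(subnSK hm) iterS permK.
Qed.

End FlipCycle.

(** * Row determinants of Hermitian matrices *)

Section CycleProducts.
Variables (R : realType) (n : nat).
Implicit Types (M N : 'M[quat R]_n) (s t : 'S_n) (c i k x : 'I_n).

Lemma cycle_prodE M s c : cycle_prod M s c =
  \prod_(0 <= j < #|porbit s c|) M (iter j s c) (iter j.+1 s c).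
Proof.
rewrite /cycle_prod; elim: #|_| => [|m IHm]; first by rewrite !big_nil.
by rewrite trajectSr -cats1 big_cat big_seq1 IHm big_nat_recr.
Qed.

Lemma eq_cycle_prod M N s t c : 
  (forall x, x \in porbit s c -> s x = t x) ->
  (forall x, x \in porbit s c -> M x (s x) = N x (s x)) ->
  porbit s c = porbit t c ->
  cycle_prod M s c = cycle_prod N t c.
Proof.
move=> hst hMN hp; rewrite !cycle_prodE -hp.
have hit j : iter j s c = iter j t c.
  elim: j => //= j <-; apply: hst.
  by rewrite -permX mem_porbit.
apply: eq_big_nat => j _; rewrite -!hit /= hMN //.
by rewrite -permX mem_porbit.
Qed.

Lemma hermitianE M x y : hermitian_mx M -> conjq (M x y) = M y x.
Proof. by move=> hM; rewrite -{2}hM !mxE. Qed.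

(** In a Hermitian matrix the entry of a reversed step is the conjugate of the
entry of the step, and conjugation reverses the order of a product. *)
Lemma cycle_prod_flip M s c x : hermitian_mx M -> x \in porbit s c ->
  cycle_prod M (flip s c) x = conjq (cycle_prod M s x).
Proof.
move=> hM hx; rewrite !cycle_prodE conjq_prod_nat flip_porbit.
have hp : porbit s x = porbit s c by apply/eqP; rewrite eq_porbit_mem.
rewrite hp; apply: eq_big_nat => j /andP[_ hj].
by rewrite hermitianE // !(iter_flip hx) // 1?ltnW // subnSK.
Qed.

Lemma cycle_prod_flip_out M s c x : x \notin porbit s c ->
  cycle_prod M (flip s c) x = cycle_prod M s x.
Proof.
move=> hx; apply: eq_cycle_prod; rewrite ?flip_porbit // => y hy.
apply: flip_out; apply: contra hx; rewrite -!eq_porbit_mem => /eqP <-.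
by rewrite eq_sym eq_porbit_mem.
Qed.

(** Moving the starting point along the cycle is a cyclic shift of the factors,
under which the real part of a product of quaternions is invariant. *)
Lemma qre_cycle_prod_step M s c :
  qre (cycle_prod M s (s c)) = qre (cycle_prod M s c).
Proof.
have hp : porbit s (s c) = porbit s c.
  by apply/eqP; rewrite eq_porbit_mem porbit_memM porbit_id.
rewrite !cycle_prodE hp.
case: #|_| (card_porbit_neq0 s c) (iter_porbit s c) => // m _ hm.
rewrite big_nat_recr //= [in RHS]big_nat_recl //= qreMC.
congr (qre (_ * _)).
  by rewrite -!iterSr; move: hm => /= hm; rewrite !hm.
by apply: eq_big_nat => j _; rewrite -!iterSr.
Qed.

Lemma qre_cycle_prod M s c x : x \in porbit s c ->
  qre (cycle_prod M s x) = qre (cycle_prod M s c).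
Proof.
case/porbitP => j ->; elim: j => [|j IHj]; first by rewrite perm1.
by rewrite expgSr permM qre_cycle_prod_step.
Qed.

Lemma flip_leader s c x : cycle_leader (flip s c) x = cycle_leader s x.
Proof. by rewrite /cycle_leader flip_porbit. Qed.

(** Reversing the cycle of [c] permutes the terms of the sum and conjugates the
middle factor only, and [q + conjq q] is twice the real part of [q]. *)
Lemma flip_average M c (D : pred 'S_n) (W V : 'S_n -> quat R) :
    hermitian_mx M ->
    (forall s, D s -> D (flip s c)) ->
    (forall s, D s -> W (flip s c) = W s) ->
    (forall s, D s -> V (flip s c) = V s) ->
  \sum_(s | D s) W s * cycle_prod M s c * V s =
  \sum_(s | D s) W s * (qre (cycle_prod M s c))%:A * V s.
Proof.
move=> hM hD hW hV; apply: double_injq.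
have hDD s : D (flip s c) = D s.
  by apply/idP/idP => [/hD|]; rewrite ?flipK //; apply: hD.
rewrite {2}(reindex_inj (can_inj (@flipK _ c))) /=.
rewrite [X in _ + X](eq_bigl D) // -!big_split /=; apply: eq_bigr => s Ds.
rewrite hW // hV // cycle_prod_flip ?porbit_id // -!mulrDl -!mulrDr.
by rewrite addq_conj scalerDl mulrDl mulrDr.
Qed.

(** [P s c] says that [c] is the chosen representative of a cycle of [s] that
is to be averaged.  The averages are made one representative at a time: while
one cycle is reversed, the products along the cycles still to be treated are
absorbed in the coefficient [W]. *)
Lemma flip_average_prod M (r : seq 'I_n) (P : 'S_n -> pred 'I_n)
    (W : 'S_n -> quat R) :
    hermitian_mx M -> uniq r ->
    (forall s c x, P s c -> P (flip s c) x = P s x) ->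
    (forall s c x, P s c -> P s x -> x != c -> x \notin porbit s c) ->
    (forall s c, c \in r -> P s c -> W (flip s c) = W s) ->
  \sum_s W s * \prod_(c <- r | P s c) cycle_prod M s c =
  \sum_s W s * (\prod_(c <- r | P s c) qre (cycle_prod M s c))%:A.
Proof.
move=> hM + Pflip Pdisj; elim: r W => [|c r IHr] W /=.
  by move=> _ _; apply: eq_bigr => s _; rewrite !big_nil scale1r.
case/andP => cr ur hW.
pose W' s := if P s c then W s * cycle_prod M s c else W s.
transitivity (\sum_s W' s * \prod_(x <- r | P s x) cycle_prod M s x).
  apply: eq_bigr => s _; rewrite /W' big_cons.
  by case: ifP => // _; rewrite mulrA.
rewrite IHr //; last first.
  (* the factor of c moved into W' involves a cycle disjoint from that of x *)
  move=> s x xr Px; have hxc : c != x by apply: contraNneq cr => ->.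
  rewrite /W' Pflip //; case: ifP => Pc; rewrite hW ?inE ?xr ?orbT //.
  by rewrite cycle_prod_flip_out //; apply: Pdisj.
rewrite (bigID (fun s => P s c)) [RHS](bigID (fun s => P s c)) /=.
congr (_ + _); last first.
  by apply: eq_bigr => s /negPf Pc; rewrite /W' big_cons Pc.
under eq_bigr => s Pc do rewrite /W' Pc.
under [RHS]eq_bigr => s Pc do rewrite big_cons Pc.
under [RHS]eq_bigr => s Pc do rewrite algqM mulrA.
pose V s := \prod_(x <- r | P s x) qre (cycle_prod M s x).
have hV s : P s c -> V (flip s c) = V s.
  move=> Pc; rewrite /V big_seq_cond [RHS]big_seq_cond.
  apply: eq_big => x; first by rewrite Pflip.
  rewrite Pflip // => /andP[xr Px].
  rewrite cycle_prod_flip_out //; apply: Pdisj => //.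
  by apply: contraNneq cr => <-.
apply: (@flip_average M c (fun s => P s c) W (fun s => (V s)%:A)) => // s Pc.
- by rewrite Pflip.
- by rewrite hW ?inE ?eqxx.
- by rewrite hV.
Qed.

Definition others_re M s i : R :=
  \prod_(c < n | (c \notin porbit s i) && cycle_leader s c)
     qre (cycle_prod M s c).

Lemma leader_uniq s c x : cycle_leader s c -> cycle_leader s x ->
  x \in porbit s c -> x = c.
Proof.
move=> /forall_inP hc /forall_inP hx xc; apply/val_inj/eqP.
by rewrite eqn_leq hc // hx // porbit_sym.
Qed.

(** The cycles that avoid [i] only see entries of [N] outside row and column
[i], where [N] is Hermitian, so their products can be averaged to real parts.
The entries in row and column [i] are arbitrary: this serves matrices [N] that
are not Hermitian themselves. *)
Lemma rdet_others_re M N i : hermitian_mx M ->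
    (forall x y, x != i -> y != i -> N x y = M x y) ->
  rdet i N = \sum_(s : 'S_n) (-1) ^+ (n - #|porbits s|) * cycle_prod N s i *
               (others_re M s i)%:A.
Proof.
move=> hM hN; rewrite /rdet.
transitivity (\sum_(s : 'S_n) (-1) ^+ (n - #|porbits s|) * cycle_prod N s i *
  \prod_(c <- index_enum 'I_n | (c \notin porbit s i) && cycle_leader s c)
    cycle_prod M s c).
  apply: eq_bigr => s _; rewrite mulrA; congr (_ * _).
  apply: eq_bigr => c /andP[hc _]; apply: eq_cycle_prod => // x hx.
  apply: hN; apply: contraNneq hc => xi; rewrite porbit_sym.
    by rewrite -xi.
  by rewrite -xi porbit_memM.
apply: (@flip_average_prod M _
  (fun s c => (c \notin porbit s i) && cycle_leader s c)) => //.
- exact: index_enum_uniq.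
- by move=> s c x _; rewrite flip_porbit flip_leader.
- move=> s c x /andP[_ hc] /andP[_ hx]; apply: contra => xc.
  exact/eqP/(leader_uniq hc hx).
- move=> s c _ /andP[hc _]; rewrite flip_porbits cycle_prod_flip_out //.
  by rewrite porbit_sym.
Qed.

(** A product over cycles, each represented by its least element: the cycle of
[i] is split off and represented by [i] itself.  [Q] selects a union of
cycles. *)
Lemma prod_leaders_split s i (Q : pred 'I_n) (F : 'I_n -> R) :
    Q i -> (forall x y, x \in porbit s y -> Q x = Q y) ->
    (forall x y, x \in porbit s y -> F x = F y) ->
  \prod_(c < n | Q c && cycle_leader s c) F c =
  F i * \prod_(c < n | Q c && (c \notin porbit s i) && cycle_leader s c) F c.
Proof.
move=> Qi hQ hF.
have [i0 i0i hi0] := arg_minnP (P := [pred c | c \in porbit s i])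
  (fun c : 'I_n => c : nat) (porbit_id s i).
have li0 : cycle_leader s i0.
  by apply/forall_inP => x; rewrite (porbit_trans _ i0i) => /hi0.
rewrite (bigD1 i0) /=; last by rewrite li0 (hQ _ _ i0i) Qi.
rewrite (hF _ _ i0i); congr (_ * _); apply: eq_bigl => c.
rewrite -!andbA; congr (_ && _); rewrite andbC.
have [lc|] := boolP (cycle_leader s c); last by rewrite !andbF.
rewrite !andbT; congr (~~ _); rewrite -(porbit_trans _ i0i).
by apply/eqP/idP => [->|/leader_uniq->//]; rewrite ?porbit_id.
Qed.

(** For Hermitian [M] this is the common value of the row determinants; unlike
[hdet] it is an explicit sum, in which the quaternionic cycle products of
[rdet] are replaced by their real parts. *)
Definition hermdet M : R :=
  \sum_(s : 'S_n) (-1) ^+ (n - #|porbits s|) *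
    \prod_(c < n | cycle_leader s c) qre (cycle_prod M s c).

Lemma flip_others_re M s i : others_re M (flip s i) i = others_re M s i.
Proof.
apply: eq_big => c; first by rewrite flip_porbit flip_leader.
by rewrite flip_porbit => /andP[hc _]; rewrite cycle_prod_flip_out.
Qed.

(** Once the other cycles have been averaged, the cycle of [i] can be averaged
too, and the result no longer depends on [i]. *)
Lemma rdet_hermitian M i : hermitian_mx M -> rdet i M = (hermdet M)%:A.
Proof.
move=> hM; rewrite (@rdet_others_re M M) //.
rewrite (@flip_average M i predT (fun s => (-1) ^+ (n - #|porbits s|))
  (fun s => (others_re M s i)%:A)) //.
- rewrite scaler_suml; apply: eq_bigr => s _.
  rewrite (@prod_leaders_split s i predT (fun c => qre (cycle_prod M s c))) //.
    by rewrite !algqM algq_sign mulrA.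
  by move=> x y; apply: qre_cycle_prod.
- by move=> s _; rewrite flip_porbits.
- by move=> s _; rewrite flip_others_re.
Qed.

End CycleProducts.

(** * Merging two cycles by a transposition *)

Section MergeCycles.
Variable T : finType.
Implicit Types (s : {perm T}) (i k u v x : T).

Lemma iter_neq s u j : (0 < j < #|porbit s u|)%N -> iter j s u != u.
Proof.
case/andP=> j0 hj; have := uniq_traject_porbit s u.
have m0 : (0 < #|porbit s u|)%N by rewrite lt0n card_porbit_neq0.
move=> /(nth_uniq u) => /(_ j 0%N); rewrite size_traject => /(_ hj m0).
by rewrite !nth_traject //= => ->; rewrite -lt0n.
Qed.

(** Below, [i] and [k] lie in different cycles of [s].  The permutation
[tperm i k * s] exchanges the images of [i] and [k], hence joins the two
cycles: from [i] it runs through the cycle of [k] up to [k], and from there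
through the cycle of [i] back to [i]. *)
Lemma merge_iter s i k u j : k \notin porbit s i -> u \in [:: i; k] ->
    (j < #|porbit s u|)%N ->
  iter j (tperm i k * s)%g (s u) = iter j s (s u).
Proof.
move=> hk hu; elim: j => // j IHj hj.
rewrite !iterS IHj 1?ltnW // permM -iterSr; congr (s _).
have hin : iter j.+1 s u \in porbit s u by rewrite -permX mem_porbit.
have hneq : iter j.+1 s u != u by apply: iter_neq.
rewrite tpermD //; rewrite eq_sym.
  move: hu hin hneq; rewrite !inE => /orP[]/eqP-> // hin _.
  by apply: contraNneq hk => e; rewrite porbit_sym -e.
move: hu hin hneq; rewrite !inE => /orP[]/eqP-> // hin _.
by apply: contraNneq hk => e; rewrite -e.
Qed.

Lemma merge_iter_full s i k u : k \notin porbit s i -> u \in [:: i; k] ->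
  iter #|porbit s u| (tperm i k * s)%g (tperm i k u) = u.
Proof.
move=> hk hu; case E : #|porbit s u| (card_porbit_neq0 s u) => [|m] // _.
rewrite iterSr permM tpermK merge_iter ?E // -iterSr -E.
exact: iter_porbit.
Qed.

Lemma merge_porbit s i k : k \notin porbit s i ->
  porbit (tperm i k * s)%g i = porbit s i :|: porbit s k.
Proof.
move=> hk; set t := (_ * s)%g.
have mem1 u x : u \in [:: i; k] -> x \in porbit s u ->
    x \in porbit t (tperm i k u).
  move=> hu; rewrite porbit_traject => /trajectP[[|j] hj ->] /=.
    by rewrite -{1}(merge_iter_full hk hu) -permX mem_porbit.
  rewrite -iterS iterSr -(merge_iter hk hu) 1?ltnW //.
  have -> : s u = t (tperm i k u) by rewrite permM tpermK.
  by rewrite -iterSr -permX mem_porbit.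
have hki : porbit t k = porbit t i.
  apply/eqP; rewrite eq_porbit_mem -(tpermL i k) porbit_sym.
  by rewrite mem1 ?inE ?eqxx ?porbit_id.
apply/eqP; rewrite finset.eqEsubset; apply/andP; split.
  apply: porbit_closed; first by rewrite finset.inE porbit_id.
  move=> y; rewrite permM; case: tpermP => [->|->|_ _].
  - by move=> _; rewrite finset.inE !porbit_memM porbit_id orbT.
  - by move=> _; rewrite finset.inE !porbit_memM porbit_id.
  - by rewrite !finset.inE !porbit_memM.
apply/fintype.subsetP => y; rewrite finset.inE => /orP[] /mem1.
  by rewrite tpermL hki; apply; rewrite inE eqxx.
by rewrite tpermR; apply; rewrite !inE eqxx orbT.
Qed.

Lemma merge_card s i k : k \notin porbit s i ->
  #|porbit (tperm i k * s)%g i| = (#|porbit s k| + #|porbit s i|)%N.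
Proof.
move=> hk; rewrite merge_porbit // addnC cardsU.
suff -> : porbit s i :&: porbit s k = finset.set0 by rewrite cards0 subn0.
apply/setP => y; rewrite !finset.inE; apply/negP => /andP[yi yk].
by move: hk; rewrite -(porbit_trans _ yi) porbit_sym yk.
Qed.

Lemma merge_porbit_out s i k x : k \notin porbit s i ->
  x \notin porbit s i -> x \notin porbit s k ->
  porbit (tperm i k * s)%g x = porbit s x.
Proof.
move=> hk hxi hxk; set t := (_ * s)%g.
have st y : y \in porbit s x -> t y = s y.
  move=> hy; rewrite permM tpermD //.
    by apply: contraNneq hxi => ->; rewrite porbit_sym.
  by apply: contraNneq hxk => ->; rewrite porbit_sym.
have hit j : iter j t x = iter j s x.
  by elim: j => //= j ->; apply: st; rewrite -permX mem_porbit.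
apply/setP => y; apply/porbitP/porbitP => -[j ->]; exists j.
  by rewrite !permX.
by rewrite !permX.
Qed.

(** By the count of cycles after multiplication by a transposition: left
multiplication by [tperm i k] exchanges the permutations that have [i] and [k]
in one cycle with those that do not. *)
Lemma merge_mem s i k : i != k ->
  (k \in porbit (tperm i k * s)%g i) = (k \notin porbit s i).
Proof.
move=> ik; have h (u : {perm T}) : i \notin porbit u k = (k \notin porbit u i).
  by rewrite porbit_sym.
have := porbits_mul_tperm (tperm i k * s)%g i k.
have := porbits_mul_tperm s i k.
rewrite /= mulgA tperm2 mul1g !h ik; lia.
Qed.

End MergeCycles.

(** * Equal rows, linearity and Cramer's rule *)

Section RowExpansion.
Variables (R : realType) (n : nat).
Implicit Types (M N : 'M[quat R]_n) (s : 'S_n) (c i k x y : 'I_n).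

(** Read from [i], the merged cycle starts with the step from [i] to [s k].  As
rows [i] and [k] agree, its entry is that of the step from [k] to [s k], so the
product is the loop at [k] followed by the loop at [i]. *)
Lemma cycle_prod_merge N s i k : k \notin porbit s i ->
    (forall y, N i y = N k y) ->
  cycle_prod N (tperm i k * s)%g i = cycle_prod N s k * cycle_prod N s i.
Proof.
move=> hk hN; set t := (_ * s)%g; rewrite !cycle_prodE merge_card //.
have step u j : u \in [:: i; k] -> (j < #|porbit s u|)%N ->
    iter j.+1 t (tperm i k u) = iter j.+1 s u.
  by move=> hu hj; rewrite iterSr permM tpermK merge_iter // -iterSr.
have ii : i \in [:: i; k] by rewrite inE eqxx.
have kk : k \in [:: i; k] by rewrite !inE eqxx orbT.
have half u : u \in [:: i; k] ->
    \prod_(0 <= j < #|porbit s u|)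
       N (iter j t (tperm i k u)) (iter j.+1 t (tperm i k u)) =
    \prod_(0 <= j < #|porbit s u|) N (iter j s u) (iter j.+1 s u).
  move=> hu; apply: eq_big_nat => -[|j] /andP[_ hj]; last first.
    by rewrite !step // ltnW.
  rewrite step //=; move: hu; rewrite !inE => /orP[]/eqP->.
    by rewrite tpermL hN.
  by rewrite tpermR hN.
rewrite (big_cat_nat (n := #|porbit s k|)) ?leq_addr //=; congr (_ * _).
  by rewrite -half // tpermR.
have shift a b (F : nat -> quat R) :
    \prod_(a <= j < a + b) F j = \prod_(0 <= j < b) F (j + a)%N.
  by rewrite -{1}[a]add0n big_addn addKn.
rewrite shift -half // tpermL.
have hm : iter #|porbit s k| t i = k.
  by rewrite -[in RHS](merge_iter_full hk kk) tpermR.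
by apply: eq_big_nat => j _; rewrite /= iterD hm.
Qed.

Lemma cycles_sign s : (-1) ^+ (n - #|porbits s|) = (-1) ^+ s :> quat R.
Proof.
rewrite -signr_odd oddB; first by rewrite /odd_perm card_ord.
by rewrite -[leqRHS]card_ord /porbits leq_imset_card.
Qed.

(** Terms are paired by [s |-> tperm i k * s], which changes the sign.  On the
merged side the product at [i] is the loop at [k] times the loop at [i]; on the
other side the loop at [k] is one of the averaged cycles, a real factor.
Averaging the loop at [k] on the merged side makes the paired terms opposite. *)
Lemma rdet_equal_rows M N i k : hermitian_mx M ->
    (forall x y, x != i -> y != i -> N x y = M x y) ->
    i != k -> (forall y, N i y = N k y) ->
  rdet i N = 0.
Proof.
move=> hM hNM ik hN; rewrite (rdet_others_re hM hNM).
rewrite (bigID (fun s : 'S_n => k \in porbit s i)) /=.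
rewrite (reindex_inj (mulgI (tperm i k))) /=.
rewrite [X in X + _](eq_bigl (fun s : 'S_n => k \notin porbit s i)); last first.
  by move=> s; apply: merge_mem.
(* V s collects the cycles of s that avoid both i and k *)
pose V s := others_re M (tperm i k * s)%g i.
have othersV s : k \notin porbit s i ->
    others_re M s i = qre (cycle_prod M s k) * V s.
  move=> hk; rewrite /others_re.
  rewrite (@prod_leaders_split _ _ s k (fun c => c \notin porbit s i)
    (fun c => qre (cycle_prod M s c))) //; last first.
  - by move=> x y; apply: qre_cycle_prod.
  - move=> x y xy; rewrite porbit_sym (porbit_sym s y).
    by have /eqP-> : porbit s x == porbit s y by rewrite eq_porbit_mem.
  congr (_ * _).
  have E c : (c \notin porbit s i) && (c \notin porbit s k) =
      (c \notin porbit (tperm i k * s)%g i).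
    by rewrite merge_porbit // finset.inE negb_or.
  apply: eq_big => c.
    rewrite E; apply: andb_id2l; rewrite -E => /andP[ci ck].
    by rewrite /cycle_leader merge_porbit_out.
  move=> /andP[/andP[ci ck] _]; congr qre; apply: eq_cycle_prod => //.
    move=> x hx; rewrite permM tpermD //.
      by apply: contraNneq ci => ->; rewrite porbit_sym.
    by apply: contraNneq ck => ->; rewrite porbit_sym.
  by rewrite merge_porbit_out.
under eq_bigr => s hk.
  rewrite cycles_sign odd_permM odd_tperm ik signr_addb expr1 mulN1r.
  rewrite cycle_prod_merge // mulNr mulNr.
  over.
rewrite sumrN; apply/eqP; rewrite addrC subr_eq0; apply/eqP.
pose W s : quat R := (-1) ^+ s.
have cM s : k \notin porbit s i -> cycle_prod N s k = cycle_prod M s k.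
  move=> hk; apply: eq_cycle_prod => // x hx.
  apply: hNM; apply: contraNneq hk => e; rewrite porbit_sym -e //.
  by rewrite porbit_memM.
transitivity (\sum_(s : 'S_n | k \notin porbit s i)
  W s * (qre (cycle_prod M s k))%:A * (cycle_prod N s i * (V s)%:A)).
  apply: eq_bigr => s hk; rewrite othersV // cycles_sign -/(W s) algqM -!mulrA.
  by congr (_ * _); rewrite !mulrA; congr (_ * _); rewrite algqC.
rewrite -flip_average //.
- by apply: eq_bigr => s hk; rewrite cM // !mulrA.
- by move=> s; rewrite flip_porbit.
- by move=> s _; rewrite /W -!cycles_sign flip_porbits.
- move=> s hk; rewrite cycle_prod_flip_out 1?porbit_sym //.
  congr (_ * _); apply: (congr1 (fun z : R => z%:A)).
  have hk' : k \notin porbit (flip s k) i by rewrite flip_porbit.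
  rewrite /V /others_re; apply: eq_big => c.
    rewrite !merge_porbit // !flip_porbit.
    apply: andb_id2l; rewrite finset.inE negb_or => /andP[ci ck].
    by rewrite /cycle_leader !merge_porbit_out ?flip_porbit.
  rewrite merge_porbit // !flip_porbit finset.inE negb_or.
  move=> /andP[/andP[ci ck] _].
  congr qre; apply: eq_cycle_prod => //; last first.
    by rewrite !merge_porbit_out ?flip_porbit.
  move=> x; rewrite merge_porbit_out ?flip_porbit // => hx.
  rewrite !permM; have -> : tperm i k x = x.
    apply: tpermD.
      by apply: contraNneq ci => ->; rewrite porbit_sym.
    by apply: contraNneq ck => ->; rewrite porbit_sym.
  rewrite flip_out //; apply: contra ck => xk.
  by rewrite -(porbit_trans _ xk) porbit_sym.
Qed.

(** The entry of row [i] is the leftmost factor of the cycle product read from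
[i], and no other factor is in row [i]: left linearity. *)
Lemma cycle_prod_row m N i s (x : 'I_m -> quat R) (F : 'I_m -> 'rV[quat R]_n) :
  cycle_prod (replace_row N i (\row_y \sum_k x k * F k 0 y)) s i =
  \sum_k x k * cycle_prod (replace_row N i (F k)) s i.
Proof.
rewrite /cycle_prod; case: #|_| (card_porbit_neq0 s i) (uniq_traject_porbit s i)
  => // l _ /= /andP[hi _].
under [RHS]eq_bigr => k _ do rewrite big_cons.
rewrite big_cons !mxE eqxx mulr_suml; apply: eq_bigr => k _.
rewrite !mxE eqxx mulrA; congr (_ * _).
rewrite big_seq_cond [RHS]big_seq_cond; apply: eq_bigr => y /andP[hy _].
by rewrite !mxE; case: eqP hy hi => // -> ->.
Qed.

Lemma rdet_row m N i (x : 'I_m -> quat R) (F : 'I_m -> 'rV[quat R]_n) :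
  rdet i (replace_row N i (\row_y \sum_k x k * F k 0 y)) =
  \sum_k x k * rdet i (replace_row N i (F k)).
Proof.
rewrite /rdet; under [RHS]eq_bigr => k _ do rewrite mulr_sumr.
rewrite exchange_big /=; apply: eq_bigr => s _.
have others v : \prod_(c < n | (c \notin porbit s i) && cycle_leader s c)
      cycle_prod (replace_row N i v) s c =
    \prod_(c < n | (c \notin porbit s i) && cycle_leader s c) cycle_prod N s c.
  apply: eq_bigr => c /andP[hc _]; apply: eq_cycle_prod => // y hy.
  rewrite mxE; case: eqP => // yi; move: hc.
  by rewrite porbit_sym -yi hy.
rewrite cycle_prod_row mulr_suml mulr_sumr; apply: eq_bigr => k _.
by rewrite !others -algq_sign -mulrA !mulr_algl scalerAr.
Qed.

Lemma replace_row_id N i : replace_row N i (row i N) = N.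
Proof. by apply/matrixP => x y; rewrite !mxE; case: eqP => [->|]. Qed.

Lemma cramer_hermitian M i (x : 'rV[quat R]_n) : hermitian_mx M ->
  rdet i (replace_row M i (x *m M)) = x 0 i * (hermdet M)%:A.
Proof.
move=> hM.
have -> : x *m M = \row_y \sum_k x 0 k * row k M 0 y.
  by apply/rowP => y; rewrite !mxE; apply: eq_bigr => k _; rewrite mxE.
rewrite rdet_row (bigD1 i) //= replace_row_id rdet_hermitian // big1 ?addr0 //.
move=> k ki; rewrite (@rdet_equal_rows M _ i k) ?mulr0 // 1?eq_sym //.
  by move=> a b /negPf ai _; rewrite mxE ai.
by move=> y; rewrite !mxE eqxx (negPf ki).
Qed.

(** The entry of column [i] is the rightmost factor of the cycle product read
from [i]: right linearity in column [i]. *)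
Lemma cycle_prod_col N (N1 N2 : 'M[quat R]_n) i s (b : quat R) :
    (forall x y, y != i -> N x y = N1 x y /\ N x y = N2 x y) ->
    (forall x, N x i = N1 x i + N2 x i * b) ->
  cycle_prod N s i = cycle_prod N1 s i + cycle_prod N2 s i * b.
Proof.
move=> h1 h2; rewrite !cycle_prodE.
case: #|_| (card_porbit_neq0 s i) (iter_porbit s i) (@iter_neq _ s i)
  => // l _ hl hneq.
rewrite !(big_nat_recr _ _ _ (leq0n l)) hl h2 /= mulrDr mulrA.
by congr (_ * _ + _ * _ * _); apply: eq_big_nat => j hj;
  rewrite -iterS; apply h1; apply: hneq.
Qed.

End RowExpansion.

(** * The conjugate transpose *)

Section ConjugateTranspose.
Variables (R : realType).

Lemma ctransmxE m n (A : 'M[quat R]_(m, n)) x y :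
  ctransmx A x y = conjq (A y x).
Proof. by rewrite !mxE. Qed.

Lemma ctransmxK m n (A : 'M[quat R]_(m, n)) : ctransmx (ctransmx A) = A.
Proof. by apply/matrixP => x y; rewrite !ctransmxE conjqK. Qed.

Lemma ctransmxM m n p (A : 'M[quat R]_(m, n)) (B : 'M[quat R]_(n, p)) :
  ctransmx (A *m B) = ctransmx B *m ctransmx A.
Proof.
apply/matrixP => x y; rewrite ctransmxE !mxE conjq_sum.
by apply: eq_bigr => k _; rewrite conjqM !ctransmxE.
Qed.

Lemma ctransmx1 n : ctransmx 1%:M = 1%:M :> 'M[quat R]_n.
Proof.
apply/matrixP => x y; rewrite ctransmxE !mxE eq_sym.
by case: eqP; rewrite ?conjq1 ?conjq0.
Qed.

Lemma hermitian_congr m n (A : 'M[quat R]_(m, n)) (M : 'M[quat R]_n) :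
  hermitian_mx M -> hermitian_mx (A *m M *m ctransmx A).
Proof. by move=> hM; rewrite /hermitian_mx !ctransmxM ctransmxK hM mulmxA. Qed.

Lemma hermitian1 n : hermitian_mx (1%:M : 'M[quat R]_n).
Proof. exact: ctransmx1. Qed.

End ConjugateTranspose.

(** * Congruence by elementary matrices *)

Section Elementary.
Variables (R : realType) (n : nat).
Implicit Types (M N A B : 'M[quat R]_n) (s : 'S_n).
Implicit Types (p q x y : 'I_n) (a b : quat R).

(** The matrix [1 + a E_pq]: a transvection if [p != q], a dilation with factor
[1 + a] if [p = q]. *)
Definition elemmx p q a : 'M[quat R]_n :=
  \matrix_(x, y) ((x == y)%:R + (if x == p then a * (q == y)%:R else 0)).

Lemma elem_mull m p q a (A : 'M[quat R]_(n, m)) x (y : 'I_m) :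
  (elemmx p q a *m A) x y = A x y + (if x == p then a * A q y else 0).
Proof.
rewrite mxE; under eq_bigr => k _ do rewrite mxE mulrDl.
rewrite big_split /=; congr (_ + _).
  rewrite (bigD1 x) //= eqxx mul1r big1 ?addr0 // => k.
  by rewrite eq_sym => /negPf ->; rewrite mul0r.
case: eqP => _; last by rewrite big1 // => k _; rewrite mul0r.
rewrite (bigD1 q) //= eqxx mulr1 big1 ?addr0 // => k.
by rewrite eq_sym => /negPf ->; rewrite mulr0 mul0r.
Qed.

Lemma ctransmx_elem p q a : ctransmx (elemmx p q a) = elemmx q p (conjq a).
Proof.
apply/matrixP => x y; rewrite ctransmxE !mxE conjqD.
rewrite [y == x]eq_sym [q == x]eq_sym [y == p]eq_sym.
congr (_ + _); first by case: eqP; rewrite ?conjq1 ?conjq0.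
by do 2!case: eqP => _; rewrite ?mulr1 ?mulr0 ?conjq0.
Qed.

Lemma elem_mulr m p q a (A : 'M[quat R]_(m, n)) (x : 'I_m) y :
  (A *m ctransmx (elemmx p q a)) x y =
  A x y + (if y == p then A x q * conjq a else 0).
Proof.
rewrite -{1}[A]ctransmxK -ctransmxM ctransmxE elem_mull conjqD.
rewrite -ctransmxE ctransmxK.
by case: eqP => _; rewrite ?conjq0 // conjqM -ctransmxE ctransmxK.
Qed.

(** The real coefficient with which the cycle product at [i] enters the row
determinant of a matrix that agrees with [M] outside row and column [i]. *)
Definition weight M s i : R := (-1) ^+ (n - #|porbits s|) * others_re M s i.

Lemma rdet_weight M N i : hermitian_mx M ->
    (forall x y, x != i -> y != i -> N x y = M x y) ->
  rdet i N = \sum_s weight M s i *: cycle_prod N s i.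
Proof.
move=> hM hN; rewrite (rdet_others_re hM hN); apply: eq_bigr => s _.
by rewrite -algq_sign mulr_algr mulr_algl scalerA mulrC.
Qed.

Lemma cycle_prod_row2 N (N1 N2 : 'M[quat R]_n) i s a :
    (forall x y, x != i -> N x y = N1 x y /\ N x y = N2 x y) ->
    (forall y, N i y = N1 i y + a * N2 i y) ->
  cycle_prod N s i = cycle_prod N1 s i + a * cycle_prod N2 s i.
Proof.
move=> h1 h2; rewrite !cycle_prodE.
case: #|_| (card_porbit_neq0 s i) (@iter_neq _ s i) => // l _ hneq.
rewrite !big_nat_recl //= h2 mulrDl -!mulrA.
by congr (_ * _ + _ * (_ * _)); apply: eq_big_nat => j hj;
  rewrite -iterS; apply h1; apply: hneq.
Qed.

(** [M] with row [p] replaced by row [u] and column [p] by column [v], including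
the entry at [(p, p)], which becomes [M u v]. *)
Definition dupmx M p u v : 'M[quat R]_n :=
  \matrix_(x, y) M (if x == p then u else x) (if y == p then v else y).

(** The congruence adds [a] times row [q] to row [p], and then column [q] times
[conjq a] to column [p].  The row determinant at [p] is left linear in row [p]
and, the other cycles being replaced by real factors, right linear in column
[p]. *)
Lemma rdet_elem_congr M p q a : hermitian_mx M ->
  rdet p (elemmx p q a *m M *m ctransmx (elemmx p q a)) =
  rdet p (dupmx M p p p) + a * rdet p (dupmx M p q p) +
  (rdet p (dupmx M p p q) + a * rdet p (dupmx M p q q)) * conjq a.
Proof.
move=> hM; set N := _ *m ctransmx _.
have NE x y : N x y = M x y + (if x == p then a * M q y else 0) +
  (if y == p then (M x q + (if x == p then a * M q q else 0)) * conjq a else 0).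
  by rewrite elem_mulr !elem_mull.
have dupE u v x y : x != p -> y != p -> dupmx M p u v x y = M x y.
  by move=> /negPf xp /negPf yp; rewrite mxE xp yp.
rewrite !(@rdet_weight M) //; try exact: dupE; last first.
  by move=> x y /negPf xp /negPf yp; rewrite NE xp yp !addr0.
have cpE s : cycle_prod N s p =
    cycle_prod (dupmx M p p p) s p + a * cycle_prod (dupmx M p q p) s p +
    (cycle_prod (dupmx M p p q) s p + a * cycle_prod (dupmx M p q q) s p)
      * conjq a.
  (* the left product, with its column p replaced by its column v *)
  pose B v : 'M[quat R]_n := \matrix_(x, y)
    (dupmx M p p v x y + (if x == p then a * dupmx M p q v x y else 0)).
  have BE v : cycle_prod (B v) s p =
      cycle_prod (dupmx M p p v) s p + a * cycle_prod (dupmx M p q v) s p.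
    apply: cycle_prod_row2 => [x y /negPf xp|y].
      by rewrite !mxE !xp addr0.
    by rewrite !mxE eqxx.
  rewrite -!BE; apply: cycle_prod_col => [x y /negPf yp|x].
    rewrite NE !mxE !yp !addr0; case: eqP => [->|_] //.
  rewrite NE !mxE eqxx; case: eqP => [->|_] //.
under eq_bigr => s _ do
  rewrite cpE !scalerDr scalerAr scalerAl scalerDr scalerAr.
by rewrite !big_split /= -!mulr_sumr -mulr_suml big_split /= -mulr_sumr.
Qed.

Lemma dupmx_id M p : dupmx M p p p = M.
Proof.
by apply/matrixP => x y; rewrite mxE; case: eqP => [->|_]; case: eqP => [->|_].
Qed.

Lemma rdet_dupmx_row M p q v : hermitian_mx M -> p != q ->
  rdet p (dupmx M p q v) = 0.
Proof.
move=> hM pq; apply: (@rdet_equal_rows R n M _ p q) => //.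
  by move=> x y /negPf xp /negPf yp; rewrite mxE xp yp.
by move=> y; rewrite !mxE eqxx [q == p]eq_sym (negPf pq).
Qed.

(** Testing [a = 1] shows that [z] is real, then testing the unit [i] that it is
zero. *)
Lemma eq0_of_real_multiples (z : quat R) :
  (forall a, exists r : R, z * conjq a = r%:A) -> z = 0.
Proof.
move=> hz; have [r] := hz 1; rewrite conjq1 mulr1 => zr.
have [r'] := hz (Quat 0 1 0 0); rewrite zr => /(congr1 (@qim_i R)) /=.
by move=> h; have -> : r = 0; [lra | rewrite scale0r].
Qed.

(** The row argument does not apply to repeated columns.  Here [z] denotes the
row determinant in question: by [rdet_elem_congr] the quaternion
[z * conjq a] is, for every [a], a difference of determinants of Hermitian
matrices, hence real. *)
Lemma rdet_dupmx_col M p q : hermitian_mx M -> p != q ->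
  rdet p (dupmx M p p q) = 0.
Proof.
move=> hM pq; apply: eq0_of_real_multiples => a.
exists (hermdet (elemmx p q a *m M *m ctransmx (elemmx p q a)) - hermdet M).
have := rdet_elem_congr p q a hM.
rewrite !(rdet_dupmx_row _ hM pq) !mulr0 !addr0 dupmx_id.
rewrite rdet_hermitian; last exact: hermitian_congr.
rewrite (rdet_hermitian p hM).
by move=> e; rewrite scalerBl e addrAC subrr add0r.
Qed.

Lemma hermdet_transvection M p q a : hermitian_mx M -> p != q ->
  hermdet (elemmx p q a *m M *m ctransmx (elemmx p q a)) = hermdet M.
Proof.
move=> hM pq; apply: alg_injq.
rewrite -(rdet_hermitian p (hermitian_congr _ hM)).
rewrite rdet_elem_congr // !(rdet_dupmx_row _ hM pq) (rdet_dupmx_col hM pq).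
rewrite dupmx_id.
by rewrite !mulr0 !addr0 mul0r addr0 rdet_hermitian.
Qed.

Lemma hermdet_dilation M p a : hermitian_mx M ->
  hermdet (elemmx p p a *m M *m ctransmx (elemmx p p a)) =
  normsq (1 + a) * hermdet M.
Proof.
move=> hM; apply: alg_injq.
rewrite -(rdet_hermitian p (hermitian_congr _ hM)).
rewrite rdet_elem_congr // dupmx_id rdet_hermitian //.
rewrite algqM -mulq_conj conjqD conjq1 mulrDr mulr1 !mulr_algr.
by rewrite -!scalerDr -scalerAl -scalerDr.
Qed.

Definition invertible A := exists B, mx_inverse A B.

(** The multiplier [nu] is required to serve both [A M A^H] and [A^H M A];
taking [M = 1], this identifies the determinants of [A A^H] and [A^H A]. *)
Definition has_multiplier A := invertible A /\ exists2 nu : R, nu != 0 &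
  forall M, hermitian_mx M ->
    hermdet (A *m M *m ctransmx A) = nu * hermdet M /\
    hermdet (ctransmx A *m M *m A) = nu * hermdet M.

Lemma normsq_conj a : normsq (conjq a) = normsq a.
Proof. by rewrite /normsq /= !sqrrN. Qed.

Lemma addq_mul a b : a + b + a * b = (1 + a) * (1 + b) - 1.
Proof.
by case: a b => [? ? ? ?] [? ? ? ?]; apply: quat_ext => /=; ring.
Qed.

Lemma elem_mul p q a b :
  elemmx p q a *m elemmx p q b = elemmx p q (a + b + (q == p)%:R * (a * b)).
Proof.
apply/matrixP => x y; rewrite elem_mull !mxE.
case: (x == p); last by rewrite !addr0.
rewrite -!addrA; congr (_ + _).
case: (q == p); case: (q == y); rewrite ?mul1r ?mul0r ?mulr1 ?mulr0 ?addr0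
  ?mulr0 ?addr0 //.
  by rewrite mulrDr !mulr1 addrCA addrA.
rewrite mulr1. by rewrite addrC.
Qed.

Lemma elem0 p q : elemmx p q 0 = 1%:M.
Proof. by apply/matrixP => x y; rewrite !mxE mul0r if_same addr0. Qed.

Lemma has_multiplier_elem p q a : (p != q) || (1 + a != 0) ->
  has_multiplier (elemmx p q a).
Proof.
move=> h; split.
  have [pq|pq] := eqVneq p q; last first.
    exists (elemmx p q (- a)); split; rewrite elem_mul eq_sym (negPf pq) mul0r.
      by rewrite subrr addr0 elem0.
    by rewrite addNr addr0 elem0.
  move: h; rewrite pq eqxx /= => a1.
  have ua : (1 + a) \is a GRing.unit by [].
  exists (elemmx q q ((1 + a)^-1 - 1)); split; rewrite elem_mul eqxx mul1r.
    by rewrite addq_mul subrKC divrr // subrr elem0.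
  by rewrite addq_mul subrKC mulVr // subrr elem0.
exists (if p == q then normsq (1 + a) else 1).
  by case: eqP h => //= _; rewrite ?oner_eq0 // normsq_eq0.
move=> M hM.
have -> : ctransmx (elemmx p q a) *m M *m elemmx p q a =
    elemmx q p (conjq a) *m M *m ctransmx (elemmx q p (conjq a)).
  by rewrite -ctransmx_elem ctransmxK.
case: eqVneq => [->|pq]; last by rewrite !hermdet_transvection ?mul1r // eq_sym.
by rewrite !hermdet_dilation // -[in 1 + conjq a]conjq1 -conjqD normsq_conj.
Qed.

Lemma invertibleM A B : invertible A -> invertible B -> invertible (A *m B).
Proof.
move=> [A' [AA' A'A]] [B' [BB' B'B]]; exists (B' *m A'); split.
  by rewrite mulmxA -(mulmxA A) BB' mulmx1.
by rewrite mulmxA -(mulmxA B') A'A mulmx1.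
Qed.

Lemma has_multiplierM A B :
  has_multiplier A -> has_multiplier B -> has_multiplier (A *m B).
Proof.
move=> [iA [a a0 hA]] [iB [b b0 hB]]; split; first exact: invertibleM.
exists (a * b); first by rewrite mulf_neq0.
move=> M hM; rewrite ctransmxM; split.
  have -> : A *m B *m M *m (ctransmx B *m ctransmx A) =
    A *m (B *m M *m ctransmx B) *m ctransmx A by rewrite !mulmxA.
  have [-> _] := hA _ (hermitian_congr B hM); have [-> _] := hB _ hM.
  by rewrite mulrA.
have -> : ctransmx B *m ctransmx A *m M *m (A *m B) =
    ctransmx B *m (ctransmx A *m M *m A) *m B by rewrite !mulmxA.
have := hermitian_congr (ctransmx A) hM; rewrite ctransmxK => hM'.
have [_ ->] := hB _ hM'; have [_ ->] := hA _ hM.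
by rewrite mulrCA mulrA.
Qed.

Lemma has_multiplier_inv A B :
  has_multiplier A -> mx_inverse A B -> has_multiplier B.
Proof.
move=> [iA [a a0 hA]] [AB BA]; split; first by exists A.
exists a^-1; first by rewrite invr_eq0.
have AB' : ctransmx B *m ctransmx A = 1%:M by rewrite -ctransmxM AB ctransmx1.
have BA' : ctransmx A *m ctransmx B = 1%:M by rewrite -ctransmxM BA ctransmx1.
move=> M hM; split; apply: (mulfI a0); rewrite mulVKf //.
  have [<- _] := hA _ (hermitian_congr B hM).
  by rewrite !mulmxA AB mul1mx -mulmxA AB' mulmx1.
have := hermitian_congr (ctransmx B) hM; rewrite ctransmxK => /hA[_ <-].
by rewrite !mulmxA BA' mul1mx -mulmxA BA mulmx1.
Qed.

End Elementary.

(** * Gaussian elimination and diagonalization by congruence *)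

Section Elimination.
Variables (R : realType) (n : nat).
Implicit Types (A B G M : 'M[quat R]_n) (i k p x y : 'I_n).

Lemma has_multiplier1 : has_multiplier (1%:M : 'M[quat R]_n).
Proof.
split; first by exists 1%:M; split; rewrite mulmx1.
exists 1; first exact: oner_neq0.
by move=> M hM; rewrite ctransmx1 mul1mx mulmx1 mul1r.
Qed.

(** [G = 1 + u e_k^T] with [u k = 0] is a product of transvections, one for each
row, none of which changes row [k]. *)
Lemma column_clearing k (u : 'I_n -> quat R) : u k = 0 ->
  exists2 G, has_multiplier G & forall m (B : 'M[quat R]_(n, m)) x (y : 'I_m),
    (G *m B) x y = B x y + u x * B k y.
Proof.
move=> uk0.
suff [G gG hG] : exists2 G, has_multiplier G &
    forall m (B : 'M[quat R]_(n, m)) x (y : 'I_m),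
    (G *m B) x y = B x y + (if x \in enum 'I_n then u x * B k y else 0).
  by exists G => // m B x y; rewrite hG mem_enum.
elim: (enum 'I_n) => [|p r [G gG hG]].
  exists 1%:M; first exact: has_multiplier1.
  by move=> m B x y; rewrite mul1mx addr0.
have [pr|pr] := boolP (p \in r).
  exists G => // m B x y; rewrite hG inE.
  by have [->|] := eqVneq x p; rewrite ?pr.
exists (elemmx p k (u p) *m G).
  apply: has_multiplierM => //; apply: has_multiplier_elem.
  by have [->|//] := eqVneq p k; rewrite uk0 addr0 oner_neq0.
move=> m B x y; rewrite -mulmxA elem_mull !hG uk0 mul0r if_same addr0 inE.
by have [->|] := eqVneq x p; rewrite ?(negPf pr) ?addr0 ?add0r.
Qed.

Lemma invertible_col A k : invertible A -> exists p, A p k != 0.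
Proof.
move=> [B [_ BA]]; apply/existsP; apply: contraT => /existsPn h.
suff : (B *m A) k k = 0 by rewrite BA mxE eqxx => /eqP; rewrite oner_eq0.
rewrite mxE big1 // => p _.
by move: (h p); rewrite negbK => /eqP ->; rewrite mulr0.
Qed.

(** Otherwise column [k] would be a combination of the columns before it, which
are unit vectors. *)
Lemma pivot_below A k : invertible A ->
    (forall x y, (y < k)%N -> A x y = (x == y)%:R) ->
  exists2 p : 'I_n, (k <= p)%N & A p k != 0.
Proof.
move=> [B [_ BA]] hA.
suff /existsP[p /andP[kp pk]] : [exists p : 'I_n, (k <= p)%N && (A p k != 0)].
  by exists p.
apply: contraT => /existsPn h.
suff : (B *m A) k k = 0 by rewrite BA mxE eqxx => /eqP; rewrite oner_eq0.
rewrite mxE big1 // => p _; have [kp|pk] := leqP k p.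
  by move: (h p); rewrite kp negbK => /eqP ->; rewrite mulr0.
suff -> : B k p = 0 by rewrite mul0r.
have : (B *m A) k p = 0 by rewrite BA mxE; case: eqP pk => // ->; rewrite ltnn.
rewrite mxE (bigD1 p) //= hA // eqxx mulr1 big1 ?addr0 // => x /negPf xp.
by rewrite hA // xp mulr0.
Qed.

(** Bring a nonzero pivot to row [k], scale it to 1, and clear the rest of
column [k].  The rows that are added vanish in the columns before [k], so these
columns keep their form. *)
Lemma elimination_step A k : invertible A ->
    (forall x y, (y < k)%N -> A x y = (x == y)%:R) ->
  exists2 G, has_multiplier G &
    forall x y, (y <= k)%N -> (G *m A) x y = (x == y)%:R.
Proof.
move=> iA hA; have [p kp pk] := pivot_below iA hA.
have row0 i y : (k <= i)%N -> (y < k)%N -> A i y = 0.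
  move=> ki yk; rewrite hA //; case: eqP ki yk => // ->.
  by rewrite leqNgt => /negbTE->.
(* G1 makes the pivot nonzero *)
have [G1 gG1 [h1 h1k]] : exists2 G1, has_multiplier G1 &
    (forall x y, (y < k)%N -> (G1 *m A) x y = (x == y)%:R) /\
    (G1 *m A) k k != 0.
  have [Ak0|Ak] := eqVneq (A k k) 0; last first.
    by exists 1%:M; [exact: has_multiplier1 | rewrite mul1mx].
  exists (elemmx k p 1).
    apply: has_multiplier_elem; have [e|//] := eqVneq k p.
    by rewrite -e Ak0 eqxx in pk.
  split => [x y yk|]; last by rewrite elem_mull eqxx Ak0 add0r mul1r.
  by rewrite elem_mull (row0 _ _ kp yk) mulr0 if_same addr0 hA.
set A1 := G1 *m A in h1 h1k; pose c := A1 k k.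
have uc : c \is a GRing.unit by [].
have row1 y : (y < k)%N -> A1 k y = 0.
  by move=> yk; rewrite h1 //; case: eqP yk => // ->; rewrite ltnn.
(* the dilation of row k by c^-1 *)
pose G2 := elemmx k k (c^-1 - 1) : 'M[quat R]_n.
have gG2 : has_multiplier G2.
  apply: has_multiplier_elem; rewrite subrKC.
  by rewrite -[_ != 0]/(c^-1 \is a GRing.unit) unitrV uc orbT.
pose A2 := G2 *m A1.
have h2 x y : (y < k)%N -> A2 x y = (x == y)%:R.
  by move=> yk; rewrite elem_mull row1 // mulr0 if_same addr0 h1.
have h2k : A2 k k = 1.
  rewrite elem_mull eqxx -/c.
  by rewrite mulrBl mul1r mulVr // subrKC.
have row2 y : (y < k)%N -> A2 k y = 0.
  by move=> yk; rewrite h2 //; case: eqP yk => // ->; rewrite ltnn.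
have [|G3 gG3 h3] :=
  @column_clearing k (fun x => if x == k then 0 else - A2 x k).
  by rewrite eqxx.
exists (G3 *m (G2 *m G1)); first by do !apply: has_multiplierM.
move=> x y; rewrite -!mulmxA -/A1 -/A2 h3 leq_eqVlt => /orP[/eqP/val_inj->|yk].
  rewrite h2k mulr1; case: eqP => [->|_]; first by rewrite h2k addr0.
  by rewrite subrr.
by rewrite row2 // mulr0 addr0 h2.
Qed.

Lemma invertible_has_multiplier A : invertible A -> has_multiplier A.
Proof.
move=> iA.
suff cleared m : (m <= n)%N -> exists2 G, has_multiplier G &
    forall x y, (y < m)%N -> (G *m A) x y = (x == y)%:R.
  have [G gG GA] := cleared n (leqnn n).
  have GA1 : G *m A = 1%:M by apply/matrixP => x y; rewrite GA // mxE.
  apply: (has_multiplier_inv gG); split => //; have [B [AB BA]] := iA.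
  by rewrite -[G]mulmx1 -AB (mulmxA G) GA1 mul1mx AB.
elim: m => [|m IHm] hm.
  by exists 1%:M => //; exact: has_multiplier1.
have [G gG hG] := IHm (ltnW hm).
have [|G' gG' hG'] := @elimination_step (G *m A) (Ordinal hm) _ hG.
  by apply: invertibleM => //; case: gG.
exists (G' *m G); first exact: has_multiplierM.
by move=> x y ym; rewrite -mulmxA hG'.
Qed.

Lemma hermitian_diag_real M i : hermitian_mx M -> M i i = (qre (M i i))%:A.
Proof. by move=> hM; apply: conjq_real; rewrite hermitianE. Qed.

(** Symmetric elimination: make the diagonal entry at [k] nonzero if necessary,
then clear column [k] by row operations; the adjoint column operations clear
row [k]. *)
Lemma diagonal_step M k : hermitian_mx M -> invertible M ->
    (forall x y, (y < k)%N -> x != y -> M x y = 0) ->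
  exists2 G, has_multiplier G &
    forall x y, (y <= k)%N -> x != y -> (G *m M *m ctransmx G) x y = 0.
Proof.
move=> hM iM dM.
have sym0 A x y : hermitian_mx A -> A x y = 0 -> A y x = 0.
  by move=> hA e; rewrite -hermitianE // e conjq0.
have [G1 gG1 [d1 h1k]] : exists2 G1, has_multiplier G1 &
    (forall x y, (y < k)%N -> x != y -> (G1 *m M *m ctransmx G1) x y = 0) /\
    (G1 *m M *m ctransmx G1) k k != 0.
  have [Mk0|Mk] := eqVneq (M k k) 0; last first.
    by exists 1%:M; [exact: has_multiplier1 | rewrite ctransmx1 mul1mx mulmx1].
  have [p pk] := invertible_col k iM.
  have kp : k != p by apply: contraNneq pk => <-; rewrite Mk0.
  have kltp : (k < p)%N.
    rewrite ltn_neqAle kp leqNgt; apply: contra pk => pltk.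
    by rewrite (sym0 M k p) // dM.
  (* M k k = 0, so adding r (M k p) times row p, and the adjoint column
     operation, creates a diagonal entry; of r = 1 and r = - 1 at least one
     makes it nonzero *)
  have key (r : R) : (elemmx k p (r *: M k p) *m M *m
      ctransmx (elemmx k p (r *: M k p))) k k =
      (r * normsq (M k p) * (2 + r * qre (M p p)))%:A.
    rewrite elem_mulr !elem_mull eqxx Mk0 add0r.
    rewrite -(hermitianE k p hM) (hermitian_diag_real p hM).
    by case: (M k p) => *; apply: quat_ext; rewrite /normsq /=; ring.
  have nz : normsq (M k p) != 0.
    by rewrite normsq_eq0; apply: contraNneq pk => e; rewrite (sym0 M k p).
  have [r rn0 r2] : exists2 r : R, r != 0 & 2 + r * qre (M p p) != 0.
    have [e|ne] := eqVneq (2 + 1 * qre (M p p)) 0; last first.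
      by exists 1 => //; exact: oner_neq0.
    exists (-1); first by rewrite oppr_eq0 oner_neq0.
    by apply/eqP => e'; clear -e e'; lra.
  exists (elemmx k p (r *: M k p)).
    by apply: has_multiplier_elem; rewrite kp.
  split=> [x y yk xy|]; last first.
    by rewrite key; apply: alg_unitq; rewrite !mulf_neq0.
  have yp : p != y by apply: contraTneq yk => <-; rewrite -leqNgt ltnW.
  have yk' : (y == k) = false by apply/eqP => e; rewrite e ltnn in yk.
  rewrite elem_mulr yk' addr0 elem_mull (dM p y) // mulr0 if_same addr0.
  exact: dM.
set M1 := G1 *m M *m ctransmx G1 in d1 h1k.
have hM1 : hermitian_mx M1 by apply: hermitian_congr.
pose c := M1 k k; have uc : c \is a GRing.unit by [].
pose u x := if x == k then 0 else - (M1 x k * c^-1).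
have [|G2 gG2 h2] := @column_clearing k u; first by rewrite /u eqxx.
exists (G2 *m G1); first exact: has_multiplierM.
have hM2 : hermitian_mx (G2 *m M1 *m ctransmx G2) by apply: hermitian_congr.
have -> : G2 *m G1 *m M *m ctransmx (G2 *m G1) = G2 *m M1 *m ctransmx G2.
  by rewrite ctransmxM !mulmxA.
have right2 B x y : (B *m ctransmx G2) x y = B x y + B x k * conjq (u y).
  rewrite -{1}[B]ctransmxK -ctransmxM ctransmxE h2 conjqD conjqM -!ctransmxE.
  by rewrite ctransmxK.
have u0 y : (y < k)%N -> u y = 0.
  move=> yk; have yk' : y != k by apply: contraTneq yk => ->; rewrite ltnn.
  by rewrite /u (negPf yk') (sym0 M1 k y) ?mul0r ?oppr0 // d1 // eq_sym.
move=> x y; rewrite leq_eqVlt => /orP[/eqP/val_inj->|yk] xy.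
  rewrite right2 /u eqxx conjq0 mulr0 addr0 h2 /u (negPf xy).
  by rewrite mulNr -mulrA mulVr // mulr1 subrr.
rewrite right2 u0 // conjq0 mulr0 addr0 h2 d1 // add0r d1 ?mulr0 //.
by apply: contraTneq yk => ->; rewrite ltnn.
Qed.

(** Only the identity permutation contributes: any other one has a cycle product
with an off-diagonal entry as its first factor. *)
Lemma hermdet_diagonal_neq0 M :
    (forall x y, x != y -> M x y = 0) -> (forall i, qre (M i i) != 0) ->
  hermdet M != 0.
Proof.
move=> dM nz; rewrite /hermdet (bigD1 1%g) //=.
rewrite [X in _ + X]big1 => [|s s1]; last first.
  have [c sc] : exists c, c != s c.
    apply/existsP; apply: contraNT s1 => /existsPn h; apply/eqP/permP => x.
    by rewrite perm1; apply/esym/eqP; move: (h x); rewrite negbK.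
  rewrite (@prod_leaders_split R _ s c predT
    (fun c => qre (cycle_prod M s c))) //.
    rewrite /cycle_prod; case: #|_| (card_porbit_neq0 s c) => // m _ /=.
    by rewrite big_cons dM // mul0r /= mul0r mulr0.
  by move=> x y; apply: qre_cycle_prod.
rewrite addr0 mulf_neq0 ?signr_eq0 //; apply/prodf_neq0 => c _.
suff -> : cycle_prod M 1%g c = M c c by [].
have p1 : porbit 1%g c = finset.set1 c.
  apply/setP => x; rewrite finset.in_set1; apply/porbitP/eqP => [[j ->]|->].
    by rewrite expg1n perm1.
  by exists 0%N; rewrite perm1.
by rewrite /cycle_prod p1 cards1 /= big_seq1 perm1.
Qed.

(** The determinant of a diagonal matrix congruent to [M] is a nonzero multiple
of that of [M]. *)
Lemma hermdet_neq0 M : hermitian_mx M -> invertible M -> hermdet M != 0.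
Proof.
move=> hM iM.
suff diag m : (m <= n)%N -> exists2 G, has_multiplier G &
    forall x y, (y < m)%N -> x != y -> (G *m M *m ctransmx G) x y = 0.
  have [G gG dG] := diag n (leqnn n).
  have [iG [nu nu0 hnu]] := gG; have [e _] := hnu M hM.
  suff : hermdet (G *m M *m ctransmx G) != 0.
    by rewrite e; apply: contra_neq => ->; rewrite mulr0.
  have hD := hermitian_congr G hM.
  apply: hermdet_diagonal_neq0 => [x y|i]; first exact: dG.
  have [|p] := @invertible_col (G *m M *m ctransmx G) i.
    apply: invertibleM; first exact: invertibleM.
    have [B [GB BG]] := iG; exists (ctransmx B).
    by split; rewrite -ctransmxM ?BG ?GB ctransmx1.
  have [->|pi] := eqVneq p i; last by rewrite dG ?eqxx.
  by apply: contra_neq => q0; rewrite (hermitian_diag_real i hD) q0 scale0r.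
elim: m => [|m IHm] hm.
  by exists 1%:M => //; exact: has_multiplier1.
have [G gG hG] := IHm (ltnW hm).
have [||G' gG' hG'] :=
  @diagonal_step (G *m M *m ctransmx G) (Ordinal hm) _ _ hG.
- exact: hermitian_congr.
- apply: invertibleM; first by apply: invertibleM => //; case: gG.
  have [[B [GB BG]] _] := gG; exists (ctransmx B).
  by split; rewrite -ctransmxM ?BG ?GB ctransmx1.
exists (G' *m G); first exact: has_multiplierM.
move=> x y ym xy; rewrite ctransmxM !mulmxA.
by have := hG' x y ym xy; rewrite !mulmxA.
Qed.

Lemma hdetE (i : 'I_n) M : hermitian_mx M -> hdet M = hermdet M.
Proof.
move=> hM; rewrite /hdet; case: xgetP => [d _ /= /(_ i)|/(_ (hermdet M)) []] /=.
  by rewrite rdet_hermitian // => /alg_injq.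
by move=> j; apply: rdet_hermitian.
Qed.

Lemma hermdet_mul_ctransmx A : invertible A ->
  hermdet (A *m ctransmx A) = hermdet (ctransmx A *m A).
Proof.
move=> /invertible_has_multiplier[_ [nu _ h]].
have [] := h 1%:M (hermitian1 _ _).
by rewrite !mulmx1 => -> ->.
Qed.

End Elimination.

(** * The determinantal representations *)

Theorem mainTheorem4 (R : realType) (n : nat) (A Ainv : 'M[quat R]_n)
    (b : 'rV[quat R]_n) (hA : mx_inverse A Ainv)
    (x : R -> 'rV[quat R]_n) (hx : forall t : R, x t = - (b *m Ainv)) :
  left_system_solution A b x /\
  (hermitian_mx A -> forall (t : R) (i : 'I_n),
     x t 0 i = - (rdet i (replace_row A i b) / (hdet A)%:A)) /\
  (forall (t : R) (i : 'I_n),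
     x t 0 i =
       - (rdet i (replace_row (A *m ctransmx A) i (b *m ctransmx A))
          / (ddet A)%:A)).
Proof.
have iA : invertible A by exists Ainv.
have [AA' A'A] := hA.
have bE : b = b *m Ainv *m A by rewrite -mulmxA A'A mulmx1.
split; last split.
- move=> t j.
  have -> : (fun u => x u 0 j) = fun=> (- (b *m Ainv)) 0 j.
    by apply/funext => u; rewrite hx.
  rewrite hx mulNmx -bE addNr [X in is_qderive _ _ X]mxE.
  by split; exact: is_derive_cst.
- move=> hermA t i; rewrite hx mxE {2}bE cramer_hermitian // (hdetE i) //.
  by rewrite mulrK // alg_unitq // hermdet_neq0.
- move=> t i.
  have hermP : hermitian_mx (A *m ctransmx A).
    by rewrite /hermitian_mx ctransmxM ctransmxK.
  have hermQ : hermitian_mx (ctransmx A *m A).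
    by rewrite /hermitian_mx ctransmxM ctransmxK.
  rewrite hx mxE {2}bE -mulmxA cramer_hermitian // /ddet (hdetE i) //.
  rewrite -hermdet_mul_ctransmx // mulrK // alg_unitq // hermdet_neq0 //.
  apply: invertibleM => //; exists (ctransmx Ainv).
  by split; rewrite -ctransmxM ?A'A ?AA' ctransmx1.
Qed.
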